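(* Let $(E,\leqslant,\mathfrak{c})$ be an enriched qoset. Then $$\mathfrak{c}^{\uparrow}(A)=\bigcup_{B\subseteq A}\big(\mathfrak{c}(B)\cap B^{\uparrow}\big)$$ for all $A\subseteq E$. Moreover, if $\mathfrak{c}$ separates points, then $$\mathfrak{c}^{\uparrow}(A)=\bigcup_{B}B^{\vee}$$ for all $A\subseteq E$, where the union runs over the subsets $B\subseteq A$ with a $\mathfrak{c}$-sup.
   Context: A qoset $(E,\leqslant)$ is a set with a reflexive transitive relation. $\downarrow A=\{x:\exists a\in A,\,x\leqslant a\}$, $\uparrow A=\{x:\exists a\in A,\,a\leqslant x\}$. $B^{\uparrow}$ is the set of upper bounds of $B$, and $B^{\vee}$ is the set of all suprema (least upper bounds) of $B$ in $E$. A preclosure operator on $E$ is a map $\mathfrak{c}:2^E\to2^E$ with $A\subseteq\mathfrak{c}(A)\subseteq\mathfrak{c}(B)$ whenever $A\subseteq B$; $A$ is $\mathfrak{c}$-closed if $\mathfrak{c}(A)=A$. An enriched qoset $(E,\leqslant,\mathfrak{c})$ is a qoset with a preclosure operator such that $\downarrow\mathfrak{c}(A)=\mathfrak{c}(A)$ for all $A\subseteq E$. The preclosure operator $\mathfrak{c}^{\uparrow}$ is defined by $\mathfrak{c}^{\uparrow}(A)=\bigcap_{B\subseteq E}\big(\mathfrak{c}(A\cap B)\cup\uparrow(A\setminus B)\big)$. $\mathfrak{c}$ separates points if, whenever $x\not\leqslant y$, there is a $\mathfrak{c}$-closed $V$ with $y\in V$ and $x\notin V$. A subset $B$ has a $\mathfrak{c}$-sup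 if $B$ has a supremum in $E$ that belongs to $\mathfrak{c}(B)$. *)

(* Defs.v *)
From HB Require Import structures.
From mathcomp Require Import all_boot all_order.
From mathcomp Require Import boolp classical_sets.
Set Implicit Arguments.
Unset Strict Implicit.
Unset Printing Implicit Defensive.
Import Order.TTheory.
Local Open Scope order_scope.
Local Open Scope classical_set_scope.

(* A qoset is a [preorderType].  The functions [ubound], [down] and
   [supremums] of classical_sets require antisymmetry ([porderType]); the
   first definitions are their analogues for a mere preorder, where a set may
   have several suprema. *)
Section Qoset.
Context {d : Order.disp_t} {E : preorderType d}.
Implicit Types (A B V : set E) (x y : E).

Definition downset A : set E := [set x | exists2 a, A a & x <= a].
Definition upset A : set E := [set x | exists2 a, A a & a <= x].
Definition upper_bounds B : set E := [set x | forall b, B b -> b <= x].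
Definition suprema B : set E :=
  [set x | upper_bounds B x /\ forall y, upper_bounds B y -> x <= y].

Implicit Types c : set E -> set E.

Definition preclosure_operator c : Prop :=
  forall A B, A `<=` B -> A `<=` c A /\ c A `<=` c B.

Definition closed_for c A : Prop := c A = A.

Definition enriched c : Prop :=
  preclosure_operator c /\ forall A, downset (c A) = c A.

Definition up_preclosure c A : set E :=
  \bigcap_(B in [set: set E]) (c (A `&` B) `|` upset (A `\` B)).

Definition separates_points c : Prop :=
  forall x y, ~ (x <= y) -> exists V, [/\ closed_for c V, V y & ~ V x].

Definition has_csup c B : Prop := exists2 x, suprema B x & c B x.

End Qoset.

(* Main.v *)
Require Import Defs.
From HB Require Import structures.
From mathcomp Require Import all_boot all_order.
From mathcomp Require Import boolp classical_sets.
Local Open Scope classical_set_scope.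

(** The intersection defining [up_preclosure c A] is decided by a single test
    set: for the principal ideal [B] of the elements below [x], no element of
    [A `\` B] lies below [x], so membership of [x] forces [x] into
    [c (A `&` B)], and [x] bounds [A `&` B].  Conversely, if [x] bounds some
    [B `<=` A] and lies in [c B], then any test set either contains [B], and
    monotonicity of [c] applies, or misses a point of [B], which lies below
    [x].

    When [c] separates points, an upper bound of [B] lying in [c B] is
    automatically a supremum ([upper_bound_in_closure_sup]): a closed set
    is a lower set, so a closed set containing another upper bound [y] contains
    [B], hence [c B], hence [x]; thus nothing separates [x] from [y].  As [c B]
    is a lower set and any two suprema of [B] are equivalent, one supremum in
    [c B] brings all of them there, which identifies the two unions. *)

Section UpPreclosure.
Context {d : Order.disp_t} {E : preorderType d}.
Variables (c : set E -> set E).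
Hypothesis hc : enriched c.
Implicit Types (A B V : set E) (x y : E).
Local Open Scope order_scope.

Lemma enriched_mono A B : A `<=` B -> c A `<=` c B.
Proof. by case: hc => pc _ AB; case: (pc _ _ AB). Qed.

Lemma enriched_lower A x y : c A y -> x <= y -> c A x.
Proof. by case: hc => _ dc cAy xy; rewrite -dc; exists y. Qed.

Lemma closed_upper_bound V B y :
  closed_for c V -> V y -> upper_bounds B y -> B `<=` V.
Proof.
move=> clV Vy By b Bb; rewrite -clV.
by apply: (@enriched_lower _ _ y); [rewrite clV | exact: By].
Qed.

Lemma up_preclosureE A :
  up_preclosure c A =
    \bigcup_(B in [set B : set E | B `<=` A]) (c B `&` upper_bounds B).
Proof.
apply/seteqP; split=> [x upx | x [B BA [cBx Bx]] B' _].
(* The principal ideal of [x] is the decisive test set. *)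
- have [cx | [a [_ nax] ax]] := upx [set b | b <= x] I; last by [].
  by exists (A `&` [set b | b <= x]) => [b []|] //; split=> // b [].
- have [BB' | /existsNP[b /not_implyP[Bb nB'b]]] := pselect (B `<=` B').
  + by left; apply: enriched_mono cBx => b Bb; split; [exact: BA | exact: BB'].
  + by right; exists b; [split; [exact: BA |] | exact: Bx].
Qed.

(** If [x] were not below another upper bound [y], a closed set containing [y]
    would omit [x]; but by [closed_upper_bound] and monotonicity such a set
    contains [c B]. *)
Lemma upper_bound_in_closure_sup B x :
  separates_points c -> c B x -> upper_bounds B x -> suprema B x.
Proof.
move=> sep cBx Bx; split=> // y By; apply: contrapT => /sep[V [clV Vy]]; apply.
by rewrite -clV; apply: enriched_mono cBx; exact: closed_upper_bound By.
Qed.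

Lemma has_csup_suprema B : has_csup c B -> suprema B `<=` c B.
Proof.
by move=> [x [Bx _] cBx] y [_ ley]; apply: enriched_lower cBx (ley _ Bx).
Qed.

End UpPreclosure.

Theorem theorem5p9 (d : Order.disp_t) (E : preorderType d)
    (c : set E -> set E) (hc : enriched c) :
  (forall A : set E,
     up_preclosure c A =
       \bigcup_(B in [set B : set E | B `<=` A]) (c B `&` upper_bounds B)) /\
  (separates_points c ->
   forall A : set E,
     up_preclosure c A =
       \bigcup_(B in [set B : set E | B `<=` A /\ has_csup c B]) suprema B).
Proof.
split=> [A | sep A]; first exact: up_preclosureE.
rewrite up_preclosureE //; apply/seteqP; split=> x.
- move=> [B BA [cBx Bx]].
  have supx : suprema B x by exact: (upper_bound_in_closure_sup _ hc).
  by exists B; [split; [exact: BA | exists x] |].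
- move=> [B [BA csB] supx]; exists B => //.
  by split; [exact: (has_csup_suprema _ hc _ csB) | case: supx].
Qed.
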